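(* $\mathrm{mdim}_{\mathbb{C}}(G_3)=20$ and $\mathrm{mdim}_{\mathbb{R}}(G_3)=28$. Moreover, there is a faithful complex representation $V$ of $G_3$ of dimension $20$ with a decomposition $V=V_r\oplus V_n$ into subrepresentations, $V_r$ being realizable over $\mathbb{R}$ (of dimension 12), such that $V_r\oplus V_n\oplus\overline{V_n}$ is realizable over $\mathbb{R}$ and yields a faithful real representation of $G_3$ of dimension $28$.
   Context: The $3\times3\times3$ Rubik's cube consists of 8 corner cubelets (3 stickers each), 12 edge cubelets (2 stickers each) and 6 face-center cubelets. $G_3$ is the group of permutations of the 48 corner and edge stickers generated by the six moves $u_3,d_3,f_3,b_3,l_3,r_3$, which rotate respectively the top, bottom, front, back, left, right layer of nine cubelets by $90^\circ$ clockwise as seen by an observer outside the cube facing that face. For a finite group $G$ and field $F$, $\mathrm{mdim}_F(G)$ is the smallest dimension of a faithful representation of $G$ over $F$. A complex representation is realizable over $\mathbb{R}$ if it is obtained by extension of scalars from a real representation; $\overline{W}$ denotes the complex conjugate representation of $W$. *)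

(* Defs.v *)
From HB Require Import structures.
From mathcomp Require Import all_boot all_order all_algebra all_fingroup.
From mathcomp Require Import mxrepresentation.
From mathcomp Require Import reals.
From mathcomp Require Export complex.

Set Implicit Arguments.
Unset Strict Implicit.
Unset Printing Implicit Defensive.
Import GRing.Theory Num.Theory.
Local Open Scope ring_scope.

(* Geometry of the 3x3x3 cube.  Cubelet positions are vectors in {-1,0,1}^3 *)
(* (x to the right, y up, z towards the front/viewer); the centre of the    *)
(* cube is the origin.  A sticker is a pair (p, n) of a cubelet position p   *)
(* and an outward unit face normal n with p . n = 1.  The corner and edge   *)
(* stickers are those whose cubelet has at least two non-zero coordinates.  *)

Definition v3 := (int * int * int)%type.

Definition dot3 (a b : v3) : int := a.1.1 * b.1.1 + a.1.2 * b.1.2 + a.2 * b.2.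
Definition cross3 (a b : v3) : v3 :=
  (a.1.2 * b.2 - a.2 * b.1.2, a.2 * b.1.1 - a.1.1 * b.2,
   a.1.1 * b.1.2 - a.1.2 * b.1.1).
Definition scale3 (k : int) (a : v3) : v3 := (k * a.1.1, k * a.1.2, k * a.2).
Definition add3 (a b : v3) : v3 := (a.1.1 + b.1.1, a.1.2 + b.1.2, a.2 + b.2).

(* Rotation by -90 degrees about the unit axis n (Rodrigues' formula with   *)
(* angle -pi/2):  v |-> -(n x v) + (n . v) n.  Seen from outside the cube,  *)
(* looking at the face with outward normal n, this is a quarter turn        *)
(* CLOCKWISE (e.g. for n = up, the front goes to the left, as in U).        *)
Definition rotq (n v : v3) : v3 := add3 (scale3 (-1) (cross3 n v)) (scale3 (dot3 n v) n).

Definition nU : v3 := (0, 1, 0).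
Definition nD : v3 := (0, -1, 0).
Definition nF : v3 := (0, 0, 1).
Definition nB : v3 := (0, 0, -1).
Definition nL : v3 := (-1, 0, 0).
Definition nR : v3 := (1, 0, 0).

Definition coords : seq int := [:: -1; 0; 1].
Definition cube_positions : seq v3 :=
  flatten [seq [seq (x, y, z) | y <- coords, z <- coords] | x <- coords].

Definition nnz (p : v3) : nat :=
  (p.1.1 != 0) + (p.1.2 != 0) + (p.2 != 0).

Definition sticker_list : seq (v3 * v3) :=
  [seq (p, n) | n <- [:: nU; nD; nF; nB; nL; nR],
                p <- [seq p <- cube_positions | (dot3 p n == 1) && (2 <= nnz p)%N]].

Definition sticker := seq_sub sticker_list.

Lemma card_sticker : #|{: sticker}| = 48%N.
Proof. by rewrite card_seq_sub; vm_compute. Qed.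

Definition turn (n : v3) (s : v3 * v3) : v3 * v3 :=
  if dot3 s.1 n == 1 then (rotq n s.1, rotq n s.2) else s.

Definition normals : seq v3 := [:: nU; nD; nF; nB; nL; nR].

Lemma turn_closed :
  all (fun n => all (fun s => turn n s \in sticker_list) sticker_list) normals.
Proof. by vm_compute. Qed.

Lemma turn_order4 :
  all (fun n => all (fun s => turn n (turn n (turn n (turn n s))) == s)
                    sticker_list) normals.
Proof. by vm_compute. Qed.

Definition turn_fun (n : v3) (s : sticker) : sticker := insubd s (turn n (val s)).

Lemma turn_funE n (s : sticker) : n \in normals -> val (turn_fun n s) = turn n (val s).
Proof.
move=> Hn; rewrite /turn_fun insubdK //.
exact: (allP (allP turn_closed n Hn) _ (valP s)).
Qed.

Lemma turn_fun_inj n : n \in normals -> injective (turn_fun n).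
Proof.
move=> Hn.
apply: (@can_inj _ _ _ (fun s => turn_fun n (turn_fun n (turn_fun n s)))) => s.
apply: val_inj; rewrite !turn_funE //.
exact/eqP/(allP (allP turn_order4 n Hn) _ (valP s)).
Qed.

Lemma nU_n : nU \in normals. Proof. by vm_compute. Qed.
Lemma nD_n : nD \in normals. Proof. by vm_compute. Qed.
Lemma nF_n : nF \in normals. Proof. by vm_compute. Qed.
Lemma nB_n : nB \in normals. Proof. by vm_compute. Qed.
Lemma nL_n : nL \in normals. Proof. by vm_compute. Qed.
Lemma nR_n : nR \in normals. Proof. by vm_compute. Qed.

Definition u3 : {perm sticker} := perm (turn_fun_inj nU_n).
Definition d3 : {perm sticker} := perm (turn_fun_inj nD_n).
Definition f3 : {perm sticker} := perm (turn_fun_inj nF_n).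
Definition b3 : {perm sticker} := perm (turn_fun_inj nB_n).
Definition l3 : {perm sticker} := perm (turn_fun_inj nL_n).
Definition r3 : {perm sticker} := perm (turn_fun_inj nR_n).

Definition G3 : {group {perm sticker}} := <<[set u3; d3; f3; b3; l3; r3]>>%G.

Definition has_faithful_rep (F : fieldType) (gT : finGroupType)
    (G : {group gT}) (n : nat) : Prop :=
  exists rG : mx_representation F G n, mx_faithful rG.

Definition mdim_is (F : fieldType) (gT : finGroupType) (G : {group gT})
    (n : nat) : Prop :=
  has_faithful_rep F G n /\ forall m, has_faithful_rep F G m -> (n <= m)%N.

(* Main.v *)
Require Import Defs.
From HB Require Import structures.
From mathcomp Require Import all_boot all_order all_algebra all_fingroup.
From mathcomp Require Import mxrepresentation mxpoly separable cyclic cyclotomic.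
From mathcomp Require Import reals complex zify.

(** Upper bounds: [G3] commutes with the permutation that spins the stickers of
    each cubelet in place, so it acts on the functions on corner stickers that
    spinning multiplies by a primitive cube root of unity (dimension 8), and on
    the functions on edge stickers that spinning multiplies by -1 (dimension 12,
    real).  The sum is faithful, and replacing the first by its realification
    (dimension 16) gives a faithful real representation.

    Lower bounds: a faithful representation is a sum of weight spaces for the
    abelian group of corner twists and edge flips.  The set of weights, which are
    functions modulo constants on corners (to Z/3) and on edges (to Z/2), is
    stable under 3-cycles of corners and, independently, under 3-cycles of edges.
    Some weight is non-trivial on corners, and some weight takes the value -1 on
    the superflip.  The orbit of the former has at least 8 elements (16 when the
    weights are also stable under inversion, as in the real case), the orbit of
    the latter at least 12.  The two orbits are disjoint unless the second weight
    is also non-trivial on corners, and then it has at least 8 * 12 conjugates. *)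

Set Implicit Arguments.
Unset Strict Implicit.
Unset Printing Implicit Defensive.
Import GRing.Theory Num.Theory.

(** * Words in the face turns *)

Definition word := seq v3.
Definition act (w : word) (s : v3 * v3) := foldl (fun s n => turn n s) s w.
Definition valid (w : word) := all (mem normals) w.

Definition face (n : v3) : {perm sticker} :=
  nth 1%g [:: u3; d3; f3; b3; l3; r3] (index n normals).
Definition wperm (w : word) : {perm sticker} := (\prod_(n <- w) face n)%g.

Lemma val_face n s : n \in normals -> val (face n s) = turn n (val s).
Proof.
by rewrite !inE => /or4P[||| /or3P[||]] /eqP->; rewrite /face /= permE turn_funE //; vm_compute.
Qed.

Lemma face_G3 n : n \in normals -> face n \in G3.
Proof.
by rewrite !inE => /or4P[||| /or3P[||]] /eqP->; apply: mem_gen; rewrite !inE eqxx ?orbT.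
Qed.

Lemma wperm_cat w1 w2 : wperm (w1 ++ w2) = (wperm w1 * wperm w2)%g.
Proof. exact: big_cat. Qed.

Lemma wperm_G3 w : valid w -> wperm w \in G3.
Proof. by move=> /allP vw; rewrite /wperm big_seq; apply: group_prod => n /vw /face_G3. Qed.

(** In a finite group the products of generators already form the generated subgroup, so clockwise
    turns suffice. *)
Lemma G3_wordP g : g \in G3 -> exists2 w, valid w & g = wperm w.
Proof.
move/gen_prodgP=> [n [c cP ->]] {g}.
have faceP i : exists2 m, m \in normals & c i = face m.
  by move: (cP i); rewrite !inE -!orbA => /or4P[||| /or3P[||]] /eqP->;
    [exists nU | exists nD | exists nF | exists nB | exists nL | exists nR].
elim: n c {cP} faceP => [|n IH] c cP.
  by exists [::] => //; rewrite big_ord0 /wperm big_nil.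
have [w vw Ew] := IH (fun i => c (lift ord0 i)) (fun i => cP _).
have [m mP Em] := cP ord0; exists (m :: w); first by rewrite /valid /= mP.
by rewrite big_ord_recl Ew Em /wperm big_cons.
Qed.

(** Numbering the stickers turns identities between permutations into equalities of lists of 48
    numbers, which evaluation decides. *)
Definition face_tables : seq (seq nat) := Eval vm_compute in
  [seq [seq index (turn n s) sticker_list | s <- sticker_list] | n <- normals].

Lemma face_tablesP :
  all2 (fun n t => (size t == 48) &&
          all2 (fun s i => (i < 48) && (turn n s == nth s sticker_list i)) sticker_list t)
       normals face_tables.
Proof. by vm_compute. Qed.

(** The left table acts first, as in products of permutations. *)
Definition tcomp (t u : seq nat) : seq nat := [seq nth 0 u i | i <- t].
Definition wtable (w : word) : seq nat :=
  foldl (fun t n => tcomp t (nth [::] face_tables (index n normals))) (iota 0 48) w.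

Definition tabulates (t : seq nat) (g : {perm sticker}) :=
  size t = 48 /\ forall s, index (val (g s)) sticker_list
                          = nth 0 t (index (val s) sticker_list).

Lemma tabulates_inj t g h : tabulates t g -> tabulates t h -> g = h.
Proof.
move=> [_ tg] [_ th]; apply/permP=> s; apply: val_inj.
by rewrite -(nth_index (nU, nU) (valP (g s))) tg -th nth_index ?(valP (h s)).
Qed.

Lemma tabulates1 : tabulates (iota 0 48) 1%g.
Proof.
split=> // s; rewrite perm1 nth_iota //.
by rewrite -[48]/(size sticker_list) index_mem (valP s).
Qed.

Lemma tabulates_comp t u g h :
  tabulates t g -> tabulates u h -> tabulates (tcomp t u) (g * h)%g.
Proof.
move=> [st tg] [su uh]; split=> [|s]; first by rewrite size_map.
rewrite permM uh tg (nth_map 0) // st.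
by rewrite -[48]/(size sticker_list) index_mem (valP s).
Qed.

Lemma all2_nth {S T : Type} (r : S -> T -> bool) x0 y0 s t i :
  all2 r s t -> i < size s -> r (nth x0 s i) (nth y0 t i).
Proof.
elim: s t i => [|x s IH] [|y t] [|i] //= /andP[rxy rst]; first by [].
exact: IH.
Qed.

Lemma tabulates_face n :
  n \in normals -> tabulates (nth [::] face_tables (index n normals)) (face n).
Proof.
move=> nN; have uS : uniq sticker_list by vm_compute.
have := all2_nth nU [::] face_tablesP; move/(_ (index n normals)).
rewrite index_mem => /(_ nN); rewrite (nth_index _ nN) => /andP[/eqP sz].
move/(all2_nth (nU, nU) 0) => tP; split=> // s; have Ls := valP s.
move: (tP (index (val s) sticker_list)); rewrite index_mem => /(_ Ls).
rewrite (nth_index _ Ls) => /andP[i48 /eqP E].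
have sz48 : size sticker_list = 48 by vm_compute.
by rewrite -[X in _ < X]sz48 in i48; rewrite (val_face s nN) E (index_uniq _ i48 uS).
Qed.

Lemma tabulates_word w : valid w -> tabulates (wtable w) (wperm w).
Proof.
elim/last_ind: w => [|w n IH]; first by rewrite /wperm big_nil => _; exact: tabulates1.
rewrite /valid all_rcons => /andP[vn vw].
rewrite /wtable foldl_rcons -cats1 wperm_cat {2}/wperm big_seq1.
by apply: tabulates_comp (IH vw) (tabulates_face vn).
Qed.

(** * Twists, flips and 3-cycles *)

(** A quarter turn has order 4, so its cube is its inverse. *)
Definition winv (w : word) : word := flatten [seq nseq 3 n | n <- rev w].
Definition wconj (b g : word) : word := winv g ++ b ++ g.
Definition wcomm (v w : word) : word := v ++ w ++ winv v ++ winv w.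

(* Item i > 0 twists cubelet i, and cubelet 0 the other way; item 0 is the empty word. *)
Definition twists (b : word) (gs : seq word) : seq word :=
  [::] :: [seq wconj b g | g <- gs].
Definition twist (T : seq word) i : word := nth [::] T i.

(* Each setup fixes the cubelet URB and brings URF to another corner. *)
Definition corner_setups : seq word :=
  [:: [::]; [:: nF]; [:: nF; nF]; winv [:: nF]; [:: nF; nD];
      [:: nF; nD; nD]; [:: nF; nF; nL; nL]].
(** [w ++ w] changes the upper layer only by twisting URF in place, and [nU] brings URB to URF.
    Hence the outer commutator twists these two corners in opposite directions and restores
    everything else. *)
Definition corner_twist : word :=
  let w := wcomm (winv [:: nR]) (winv [:: nD]) in wcomm (w ++ w) [:: nU].
(** The two factors of the commutator move only one common cubelet, URB, so it is a 3-cycle of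
    corners. *)
Definition corner_cycle : word := wcomm (wconj [:: nF] (winv [:: nU])) [:: nB].

(* Each setup fixes the cubelet UR and brings UF to another edge. *)
Definition edge_setups : seq word :=
  [:: [::]; [:: nF]; [:: nF; nF]; winv [:: nF]; [:: nF; nF; nD];
      [:: nF; nF; nD; nD]; [:: nF; nF] ++ winv [:: nD];
      winv [:: nF] ++ [:: nL; nL]; winv [:: nF] ++ winv [:: nL];
      [:: nF; nF; nD; nD; nB]; [:: nF; nF; nD; nD; nB; nB]].
(** The first factor changes the upper layer only by flipping UF in place, and [nU] brings UR to UF,
    so the commutator flips exactly these two edges. *)
Definition edge_flip : word :=
  wcomm (winv [:: nU; nF] ++ [:: nD; nR; nR; nD; nD; nU; nU] ++ winv [:: nU; nL])
        [:: nU].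
(** Up to a rotation of the whole cube, R^-1 L is a quarter turn of the middle slice. The conjugated
    word is thus the commutator of a slice turn with a half turn of the upper layer, a 3-cycle of
    edges. *)
Definition edge_cycle : word :=
  wconj (winv [:: nR] ++ [:: nL; nF; nF] ++ winv [:: nL] ++ [:: nR; nU; nU])
        (winv [:: nR; nB]).

Definition corner_twists := twists corner_twist corner_setups.
Definition edge_flips := twists edge_flip edge_setups.
Definition corner_cycles := [seq wconj corner_cycle g | g <- corner_setups].
Definition edge_cycles := [seq wconj edge_cycle g | g <- edge_setups].

(* A sticker of cubelet i, for the numbering in which [twist T i] moves i and 0. *)
Definition refs (s0 s1 : v3 * v3) (gs : seq word) := s0 :: [seq act g s1 | g <- gs].
Definition corner_refs := refs ((1, 1, -1)%R, nU) ((1, 1, 1)%R, nU) corner_setups.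
Definition edge_refs := refs ((1, 1, 0)%R, nU) ((0, 1, 1)%R, nU) edge_setups.

(* The cubelets that a word brings to each of the numbered places. *)
Definition source (r : seq (v3 * v3)) (c : word) : seq nat :=
  let im := [seq (act c s).1 | s <- r] in [seq index s.1 im | s <- r].

Definition tables (T : seq word) := [seq wtable w | w <- T].
Definition commuting_tables (t u : seq nat) := tcomp t u == tcomp u t.

(* With t_i of order d, that c t_i = t_(p i) t_(p 0)^-1 c for all i. *)
Definition conj_rel d (T : seq (seq nat)) (c : seq nat) (p : seq nat) :=
  let id48 := iota 0 48 in
  all (fun i => tcomp c (nth id48 T i) ==
    foldl tcomp (nth id48 T (nth 0 p i)) (rcons (nseq d.-1 (nth id48 T (nth 0 p 0))) c))
    (iota 0 (size T)).

(** * Relations between twists, flips and 3-cycles, checked on tables *)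

Lemma valid_words : all (all valid) [:: corner_twists; edge_flips; corner_cycles; edge_cycles].
Proof. by vm_compute. Qed.

Lemma twists_commute : all2rel commuting_tables (tables (corner_twists ++ edge_flips)).
Proof. by vm_compute. Qed.

Lemma twists_order :
  all (fun t => tcomp (tcomp t t) t == iota 0 48) (tables corner_twists) &&
  all (fun t => tcomp t t == iota 0 48) (tables edge_flips).
Proof. by vm_compute. Qed.

(** Conjugation by [c] carries the twist of cubelet i, with the opposite twist of cubelet 0, to the
    places p i and p 0. In t_(p i) t_(p 0)^-1 the contributions at cubelet 0 cancel, leaving just
    these two. *)
Lemma corner_cycles_rel :
  let T := tables corner_twists in let S := tables edge_flips in
  all (fun c => let t := wtable c in
        conj_rel 3 T t (source corner_refs c) && all (commuting_tables t) S) corner_cycles.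
Proof. by vm_compute. Qed.

Lemma edge_cycles_rel :
  let T := tables corner_twists in let S := tables edge_flips in
  all (fun c => let t := wtable c in
        conj_rel 2 S t (source edge_refs c) && all (commuting_tables t) T) edge_cycles.
Proof. by vm_compute. Qed.

Lemma twist_table : wtable (twist corner_twists 1) != iota 0 48.
Proof. by vm_compute. Qed.

(** Each of the 11 non-trivial items flips cubelet 0, an odd number of times in all, so the product
    flips all 12 edges. *)
Lemma superflip_table : wtable (flatten edge_flips) != iota 0 48.
Proof. by vm_compute. Qed.

(** The default [iota 0 48] is the table of the empty word, the default of [twist]. *)
Lemma nth_tables T i : nth (iota 0 48) (tables T) i = wtable (twist T i).
Proof. by elim: T i => [|w T IH] [|i] //=; apply: IH. Qed.

Lemma valid_twist T i : all valid T -> valid (twist T i).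
Proof. by elim: T i => [|w T IH] [|i] //= /andP[vw vT] //; apply: IH. Qed.

Lemma tabulates_foldl t u g h k : tabulates t g -> tabulates u h ->
  tabulates (foldl tcomp t (nseq k u)) (g * h ^+ k)%g.
Proof.
move=> tg uh; elim: k t g tg => [|k IH] t g tg; first by rewrite mulg1.
by rewrite expgS mulgA; apply/IH/tabulates_comp.
Qed.

Lemma conj_relP d T c p i : valid c -> all valid T ->
    conj_rel d (tables T) (wtable c) p -> i < size T ->
  (wperm c * wperm (twist T i)
   = wperm (twist T (nth 0 p i)) * wperm (twist T (nth 0 p 0)) ^+ d.-1 * wperm c)%g.
Proof.
move=> vc vT /allP/(_ i) + lti; rewrite mem_iota size_map lti => /(_ isT) /eqP.
rewrite !nth_tables foldl_rcons => E.
have tabw j : tabulates (wtable (twist T j)) (wperm (twist T j)).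
  exact/tabulates_word/valid_twist.
apply: tabulates_inj (tabulates_comp (tabulates_word vc) (tabw i)) _.
by rewrite E; apply: tabulates_comp (tabulates_word vc); apply: tabulates_foldl.
Qed.

Lemma commuting_tablesP v w : valid v -> valid w ->
  commuting_tables (wtable v) (wtable w) -> commute (wperm v) (wperm w).
Proof.
move=> vv vw /eqP E.
apply: tabulates_inj (tabulates_comp (tabulates_word vv) (tabulates_word vw)) _.
by rewrite E; apply: tabulates_comp; apply: tabulates_word.
Qed.

Lemma wtable_neq1 w : valid w -> wtable w != iota 0 48 -> wperm w != 1%g.
Proof.
move=> vw; apply: contraNneq => w1; have [sz tP] := tabulates_word vw; apply/eqP.
have uS : uniq sticker_list by vm_compute.
have sz48 : size sticker_list = 48 by vm_compute.
apply: (@eq_from_nth _ 0); rewrite sz // => i; rewrite -[X in _ < X]sz48 => lti.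
have [s vs] : exists s : sticker, val s = nth (nU, nU) sticker_list i.
  by exists (SeqSub (mem_nth (nU, nU) lti)).
have := tP s; rewrite w1 perm1 vs (index_uniq _ lti uS) => <-.
by rewrite nth_iota // -sz48.
Qed.

(** * Orbits of exponents *)

(* a_i |-> a_(p i) - a_(p 0) on exponents reduced mod d. *)
Definition move d (p a : seq nat) : seq nat :=
  let c := d - nth 0 a (nth 0 p 0) in
  [seq let x := nth 0 a i + c in if x < d then x else x - d | i <- p].

Definition opposite d (a : seq nat) : seq nat :=
  [seq if i == 0 then 0 else d - i | i <- a].
(* [None] stands for the inversion of weights. *)
Definition omove d (o : option (seq nat)) : seq nat -> seq nat :=
  if o is Some p then move d p else opposite d.

(* Breadth-first search, given up as soon as N elements are found. *)
Definition explore {I T : eqType} (f : I -> T -> T) (ms : seq I) N fuel (x : T) : seq T :=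
  foldl (fun X j => foldl (fun X i =>
           if N <= size X then X else
           let y := f i (nth x X j) in if y \in X then X else rcons X y) X ms)
    [:: x] (iota 0 fuel).

(** Even an interrupted search yields distinct points of the orbit, hence a lower bound on its
    size. *)
Lemma exploreP {I T : eqType} (f : I -> T -> T) (ms : seq I) N fuel x (P : T -> Prop) :
  P x -> (forall i y, i \in ms -> P y -> P (f i y)) ->
  uniq (explore f ms N fuel x) /\ {in explore f ms N fuel x, forall y, P y}.
Proof.
move=> Px Pf; rewrite /explore.
pose good X := uniq X /\ {in X, forall y, P y}.
have : good [:: x] by split=> // y /[!inE] /eqP->.
elim: (iota 0 fuel) [:: x] => [|j js IH] X gX //=; apply: IH.
have : {subset ms <= ms} by [].
elim: {1 3}ms X gX => [|i ms' IH] X gX //= sub.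
have ims : i \in ms by apply: sub; rewrite mem_head.
apply: IH => [|i' i'ms]; last by apply: sub; rewrite inE i'ms orbT.
case: ifP => // _; case: ifP => // /negbT notX; case: gX => uX PX; split.
  by rewrite rcons_uniq notX.
(* Past the end of [X], [nth] returns the starting point [x], where [P] holds too. *)
have Pn : P (nth x X j).
  by have [ltj|gej] := ltnP j (size X); [exact/PX/mem_nth | rewrite nth_default].
by move=> y; rewrite mem_rcons inE => /predU1P[->|/PX//]; apply: Pf.
Qed.

Definition corner_moves := [seq Some (source corner_refs c) | c <- corner_cycles].
Definition edge_moves := [seq Some (source edge_refs c) | c <- edge_cycles].

Fixpoint exponents d m : seq (seq nat) :=
  if m is k.+1 then [seq i :: s | i <- iota 0 d, s <- exponents d k] else [:: [::]].

Lemma mem_exponents d s : all (fun i => i < d) s -> s \in exponents d (size s).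
Proof.
elim: s => //= i s IH /andP[ltid lts]; apply/allpairsP; exists (i, s).
by rewrite mem_iota ltid IH.
Qed.

(** The leading 0 is the exponent of the empty word: it normalizes a function on the 8 corners
    modulo constants by its value at URB. That the points found avoid zero will separate them from
    weights trivial on corners. *)
Definition large_corner_orbits N (ms : seq (option (seq nat))) :=
  all (fun a => (a == nseq 7 0) ||
        let X := explore (omove 3) ms N N (0 :: a) in (N <= size X) && (nseq 8 0 \notin X))
      (exponents 3 7).

(** The bound is attained by the indicator functions of single corners. *)
Lemma corner_orbits : large_corner_orbits 8 corner_moves.
Proof. by vm_compute. Qed.

(** Modulo constants, the indicator functions of single corners differ from their negatives, whence
    16. *)
Lemma corner_opp_orbits : large_corner_orbits 16 (rcons corner_moves None).
Proof. by vm_compute. Qed.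

(** An odd sum expresses the value -1 on the superflip. The bound is attained by the indicator
    functions of single edges. *)
Lemma edge_orbits :
  all (fun b => odd (sumn b) ==> (12 <= size (explore (omove 2) edge_moves 12 12 (0 :: b))))
      (exponents 2 11).
Proof. by vm_compute. Qed.

Local Open Scope ring_scope.

(** * Weights of abelian subgroups *)

Lemma prim_root_exists (F : numClosedFieldType) n :
  (0 < n)%N -> exists z : F, n.-primitive_root z.
Proof.
move=> n0; have [r Dr] := closed_field_poly_normal ('X^n - 1 : {poly F}).
rewrite (monicP _) ?monicXnsubC // scale1r in Dr.
have [|||z] := hasP (@has_prim_root F n r n0 _ _ _); last by exists z.
- by apply/allP=> z; rewrite -root_prod_XsubC -Dr.
- by rewrite -separable_prod_XsubC -Dr separable_Xn_sub_1 // pnatr_eq0 -lt0n.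
- by rewrite -ltnS -(size_prod_XsubC r id) -Dr size_XnsubC.
Qed.

(** With m the order of [x], the matrix is killed by ['X^m - 1], which splits with distinct
    roots. *)
Lemma repr_diagonalizable (F : numClosedFieldType) (gT : finGroupType)
    (G : {group gT}) n (rG : mx_representation F G n) x :
  x \in G -> diagonalizable (rG x).
Proof.
case: n rG => [|n] rG Gx; first by rewrite [rG x]thinmx0; exact: diagonalizable0.
have [z pz] := prim_root_exists F (order_gt0 x).
have rX m : rG x ^+ m = rG (x ^+ m)%g.
  elim: m => [|m IH]; first by rewrite expr0 expg0 repr_mx1.
  by rewrite exprS expgS IH repr_mxM ?groupX.
apply/diagonalizableP; exists [seq z ^+ i | i <- index_iota 0 #[x]%g].
  rewrite map_inj_in_uniq ?iota_uniq // => i j; rewrite !mem_index_iota /= => lti ltj /eqP.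
  by rewrite (eq_prim_root_expr pz) !modn_small // => /eqP.
rewrite big_map (factor_Xn_sub_1 pz) mxminpoly_min //.
by rewrite rmorphB rmorphXn /= horner_mx_X rmorph1 rX expg_order repr_mx1 subrr.
Qed.

(** Commuting diagonalizable matrices share a diagonalizing basis [P]; the weights are the diagonal
    entries and the eigenvectors are the rows of [P]. The second clause allows a subset [B] so that
    it applies to the part of [A] that a conjugation keeps in [A]. *)
Lemma abelian_weights (F : numClosedFieldType) (gT : finGroupType) (G A : {group gT}) n
    (rG : mx_representation F G n) : A \subset G -> abelian A ->
  exists wt : 'I_n -> gT -> F,
  [/\ forall k, exists2 v : 'rV_n, v != 0 & {in A, forall x, v *m rG x = wt k x *: v},
      forall (B : {pred gT}) chi (v : 'rV_n), {subset B <= A} -> v != 0 ->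
        {in B, forall x, v *m rG x = chi x *: v} ->
        exists k, {in B, forall x, wt k x = chi x}
    & {in A, forall x, (forall k, wt k x = 1) -> rG x = 1%:M}].
Proof.
move=> sAG abA.
have codG : codiagonalizable [seq rG x | x <- enum A].
  apply/codiagonalizableP; split=> [M N|M].
    move=> /mapP[x]; rewrite mem_enum => Ax -> /mapP[y]; rewrite mem_enum => Ay ->.
    rewrite /comm_mx -!repr_mxM ?(subsetP sAG) //.
    by rewrite (centsP abA x Ax y Ay).
  move=> /mapP[x]; rewrite mem_enum => Ax ->.
  exact/repr_diagonalizable/(subsetP sAG).
case: codG => P uP /allP dP; pose D x := P *m rG x *m invmx P.
have diagD x i j : x \in A -> i != j -> D x i j = 0.
  move=> Ax ij; have dx : diagonalizable_for P (rG x).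
    by apply: dP; apply: map_f; rewrite mem_enum.
  exact: (elimT (diagonalizable_forP _ uP) dx).
have PD x : P *m rG x = D x *m P by rewrite mulmxKV.
exists (fun k x => D x k k); split.
- move=> k; exists (row k P).
    apply/eqP=> Pk0; have /rowP/(_ k)/eqP : row k (P *m invmx P) = 0.
      by rewrite row_mul Pk0 mul0mx.
    by rewrite mulmxV // !mxE eqxx oner_eq0.
  move=> x Ax; rewrite -row_mul PD; apply/rowP=> j; do 2!rewrite [LHS]mxE.
  rewrite (bigD1 k) //= big1 ?addr0; first by rewrite [RHS]mxE [row k P _ _]mxE.
  by move=> i; rewrite eq_sym => ik; rewrite diagD // mul0r.
(* Any non-zero coordinate of [v] in the basis [P] picks out a weight that agrees with [chi]. *)
- move=> B chi v sBA v0 vB; pose c := v *m invmx P.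
  have /rV0Pn[k ck] : c != 0.
    by apply: contraNneq v0 => c0; rewrite -(mulmxKV uP v) -/c c0 mul0mx.
  exists k => x Bx; apply: (mulfI ck).
  have /rowP/(_ k) : c *m D x = chi x *: c.
    by rewrite /c /D !mulmxA mulmxKV // vB // scalemxAl.
  rewrite [LHS]mxE [RHS]mxE (bigD1 k) //= big1 ?addr0 => [E|i ik].
    by rewrite E mulrC.
  by rewrite diagD ?mulr0 // sBA.
move=> x Ax wt1; rewrite -[rG x](mulKmx uP) PD.
suff -> : D x = 1%:M by rewrite mul1mx mulVmx.
apply/matrixP=> i j; rewrite [RHS]mxE; have [<-|ij] := eqVneq i j; first by rewrite wt1.
by rewrite diagD.
Qed.

(** * Monomial representations *)

Section Monomial.

Variables (F : fieldType) (T : finType) (G : {group {perm T}}) (n : nat).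
Variables (phi : T -> 'rV[F]_n) (r : 'I_n -> T) (B : pred T) (sp : T -> T) (z : F).
Hypothesis phi_r : forall i, phi (r i) = delta_mx 0 i.
Hypothesis r_B : forall i, B (r i).
Hypothesis sp_B : forall x, B x -> B (sp x).
Hypothesis phi_sp : forall x, B x -> phi (sp x) = z *: phi x.
Hypothesis B_sp : forall x, B x -> exists i k, x = iter k sp (r i).
Hypothesis G_sp : {in G, forall (g : {perm T}) x, g (sp x) = sp (g x)}.
Hypothesis G_B : {in G, forall (g : {perm T}) x, B x -> B (g x)}.

Definition monomial_mx (g : {perm T}) : 'M[F]_n := \matrix_i phi (g (r i)).

(** By definition the formula holds at the reference points, and it propagates along spins because
    [g] commutes with [sp]. *)
Lemma monomial_mxE g x : g \in G -> B x -> phi (g x) = phi x *m monomial_mx g.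
Proof.
move=> Gg /B_sp[i [k ->]]; have Bk y m : B y -> B (iter m sp y).
  by elim: m => //= m IH /IH /sp_B.
elim: k => [|k IH] /=; first by rewrite phi_r -rowE rowK.
by rewrite G_sp // !phi_sp ?IH ?scalemxAl // ?G_B ?Bk.
Qed.

Lemma monomial_mx_repr : mx_repr G monomial_mx.
Proof.
split=> [|g h Gg Gh]; apply/row_matrixP=> i.
  by rewrite rowK perm1 phi_r row1.
by rewrite row_mul !rowK permM monomial_mxE // G_B.
Qed.

Definition monomial_repr := MxRepresentation monomial_mx_repr.

End Monomial.

(* The next face counterclockwise around a corner; the other face of an edge, for
   which the last test is vacuous since the cross product is orthogonal to [s.1]. *)
Definition spin (s : v3 * v3) : v3 * v3 :=
  (s.1, head s.2 [seq m <- normals |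
          [&& dot3 s.1 m == 1, m != s.2 & 0 <= dot3 (cross3 s.2 m) s.1]]).

(* Item [i * d + k] is the [k]-th spin of a reference sticker of the [i]-th
   cubelet with [d] stickers. *)
Definition blocks d : seq (v3 * v3) :=
  flatten [seq traject spin (p, head nU [seq m <- normals | dot3 p m == 1]) d
          | p <- cube_positions & nnz p == d].

Definition spin_index d i := ((i %/ d) * d + (i %% d).+1 %% d)%N.

Definition blocks_spec d n :=
  let L := blocks d in
  [&& size L == (n * d)%N, uniq L,
      all (fun s => [&& s \in sticker_list, spin s \in L &
                        index (spin s) L == spin_index d (index s L)]) L,
      all (fun i => nth (nU, nU) L i == iter (i %% d) spin (nth (nU, nU) L (i %/ d * d)))
          (iota 0 (n * d))
    & all (fun m => all (fun s => turn m s \in L) L) normals].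

Lemma corner_blocks : blocks_spec 3 8.
Proof. by vm_compute. Qed.

Lemma edge_blocks : blocks_spec 2 12.
Proof. by vm_compute. Qed.

Lemma stickers_blocks : all (fun s => (s \in blocks 3) || (s \in blocks 2)) sticker_list.
Proof. by vm_compute. Qed.

Lemma spin_turn :
  all (fun s => (spin s \in sticker_list) &&
                all (fun m => turn m (spin s) == spin (turn m s)) normals) sticker_list.
Proof. by vm_compute. Qed.

Lemma sticker0_subproof : ((0, 1, 1), nU) \in sticker_list.
Proof. by vm_compute. Qed.
Definition sticker0 : sticker := SeqSub sticker0_subproof.

Definition spinS (s : sticker) : sticker := insubd s (spin (val s)).

Lemma val_spinS s : val (spinS s) = spin (val s).
Proof.
rewrite /spinS insubdK //.
by have /andP[] := allP spin_turn _ (valP s).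
Qed.

Lemma G3_ind (P : {perm sticker} -> Prop) :
  P 1%g -> (forall m g, m \in normals -> P g -> P (face m * g)%g) ->
  {in G3, forall g, P g}.
Proof.
move=> P1 PM _ /G3_wordP[w vw ->]; elim: w vw => [|m w IH] /=.
  by rewrite /wperm big_nil.
by case/andP=> mN vw; rewrite /wperm big_cons; apply: PM (IH vw).
Qed.

Lemma G3_spin : {in G3, forall (g : {perm sticker}) s, g (spinS s) = spinS (g s)}.
Proof.
apply: G3_ind => [s|m g mN IH s]; first by rewrite !perm1.
rewrite !permM -IH; congr (g _); apply: val_inj; rewrite !(val_spinS, val_face) //.
have /andP[_ /allP/(_ m mN)/eqP->] := allP spin_turn _ (valP s); by [].
Qed.

(** * The representation on functions that spinning multiplies by a root of unity *)

Section CubeletRepresentation.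

Variables (F : fieldType) (d n : nat) (z : F).
Hypothesis prim_z : d.-primitive_root z.
Hypothesis dn : blocks_spec d n.

Let d0 : (0 < d)%N := prim_order_gt0 prim_z.
Let L := blocks d.
Let in_block (s : sticker) := val s \in L.
Let ref (i : 'I_n) : sticker := insubd sticker0 (nth (nU, nU) L (i * d)%N).
Let phi (s : sticker) : 'rV[F]_n :=
  \row_j (if (index (val s) L %/ d)%N == j then z ^+ (index (val s) L %% d) else 0).

Let sizeL : size L = (n * d)%N. Proof. by case/and5P: dn => /eqP. Qed.
Let uniqL : uniq L. Proof. by case/and5P: dn. Qed.
Let L_spin s : s \in L ->
  [/\ s \in sticker_list, spin s \in L & index (spin s) L = spin_index d (index s L)].
Proof. by case/and5P: dn => _ _ /allP sP _ _ /sP/and3P[? ? /eqP]. Qed.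

Let ltn_ref (i : 'I_n) : (i * d < size L)%N.
Proof. by rewrite sizeL ltn_pmul2r. Qed.

Let val_ref i : val (ref i) = nth (nU, nU) L (i * d)%N.
Proof. by rewrite insubdK //; case: (L_spin (mem_nth (nU, nU) (ltn_ref i))). Qed.

Let ref_block i : in_block (ref i).
Proof. by rewrite /in_block val_ref mem_nth. Qed.

Let phi_ref i : phi (ref i) = delta_mx 0 i.
Proof.
apply/rowP=> j; rewrite !mxE val_ref index_uniq // mulnK // modnMl expr0 eqxx /=.
by rewrite -val_eqE /= eq_sym; case: eqP.
Qed.

Let spin_block s : in_block s -> in_block (spinS s).
Proof. by rewrite /in_block val_spinS => /L_spin[]. Qed.

Let phi_spin s : in_block s -> phi (spinS s) = z *: phi s.
Proof.
move=> /L_spin[_ _ Es]; apply/rowP=> j; rewrite !mxE val_spinS Es /spin_index.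
set i := index _ _; have ltd : ((i %% d).+1 %% d < d)%N by rewrite ltn_mod.
rewrite divnMDl // (divn_small ltd) addn0 modnMDl (modn_small ltd).
by case: eqP; rewrite ?mulr0 // -exprS (prim_expr_mod prim_z).
Qed.

Let block_spin s : in_block s -> exists i k, s = iter k spinS (ref i).
Proof.
move=> Ls; set i := index (val s) L.
have ltid : (i < n * d)%N by rewrite -sizeL index_mem.
have ltin : (i %/ d < n)%N by rewrite ltn_divLR.
exists (Ordinal ltin), (i %% d)%N; apply: val_inj.
have -> k x : val (iter k spinS x) = iter k spin (val x).
  by elim: k => //= k <-; exact: val_spinS.
case/and5P: dn => _ _ _ /allP/(_ i) + _; rewrite mem_iota /= => /(_ ltid)/eqP E.
by rewrite val_ref -E nth_index.
Qed.

Let G3_block : {in G3, forall (g : {perm sticker}) s, in_block s -> in_block (g s)}.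
Proof.
apply: G3_ind => [s|m g mN IH s Ls]; first by rewrite perm1.
rewrite permM; apply: IH; rewrite /in_block val_face //.
by case/and5P: dn => _ _ _ _ /allP/(_ m mN)/allP; apply.
Qed.

Definition cubelet_repr : mx_representation F G3 n :=
  monomial_repr phi_ref ref_block spin_block phi_spin block_spin G3_spin G3_block.

(** [phi] is injective on the block: the position of its non-zero coordinate tells the cubelet, and
    the power of the primitive root [z] tells the sticker on it. *)
Lemma cubelet_repr_fix g (s : sticker) :
  g \in G3 -> cubelet_repr g = 1%:M -> val s \in blocks d -> g s = s.
Proof.
move=> Gg g1 Ls; have Lg : in_block (g s) by apply: G3_block.
have : phi (g s) = phi s.
  rewrite (monomial_mxE phi_ref ref_block spin_block phi_spin block_spin G3_spin G3_block Gg Ls).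
  by rewrite -[monomial_mx _ _ _]/(cubelet_repr g) g1 mulmx1.
move: Lg Ls; rewrite /in_block -/L => Lg Ls.
have ltin : (index (val s) L %/ d < n)%N by rewrite ltn_divLR // -sizeL index_mem.
move/rowP/(_ (Ordinal ltin)); rewrite !mxE /= eqxx.
have z0 : z != 0.
  apply/eqP=> z0; have /eqP := prim_expr_order prim_z.
  by rewrite z0 expr0n eqn0Ngt d0 eq_sym oner_eq0.
case: eqP => [Ed /eqP|_ /esym/eqP]; last by rewrite expf_eq0 (negbTE z0) andbF.
rewrite (eq_prim_root_expr prim_z) !modn_mod => /eqP Em; apply: val_inj.
rewrite -[LHS](nth_index (nU, nU) Lg) -[RHS](nth_index (nU, nU) Ls).
by rewrite (divn_eq (index _ L) d) Ed Em -divn_eq.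
Qed.

End CubeletRepresentation.

Lemma cubelet_faithful (F1 F2 : fieldType) (z1 : F1) (z2 : F2)
    (p1 : 3.-primitive_root z1) (p2 : 2.-primitive_root z2) g :
  g \in G3 -> cubelet_repr p1 corner_blocks g = 1%:M ->
  cubelet_repr p2 edge_blocks g = 1%:M -> g = 1%g.
Proof.
move=> Gg g1 g2; apply/permP=> s; rewrite perm1.
have /orP[] := allP stickers_blocks _ (valP s).
  exact: cubelet_repr_fix g1.
exact: cubelet_repr_fix g2.
Qed.

(** * The faithful representations *)

Lemma prim_root_opp1 (F : numDomainType) : 2.-primitive_root (-1 : F).
Proof.
apply/andP; split=> //; apply/forallP=> -[[|[|i]] lti] //=; rewrite unity_rootE.
  have two : 1 + 1 != 0 :> F by rewrite -mulr2n pnatr_eq0.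
  have /negbTE n1 : (-1 : F) != 1 by apply: contra two => /eqP E; rewrite -{1}E addNr.
  by rewrite expr1 n1.
by rewrite sqrrN expr1n !eqxx.
Qed.

Lemma mx_repr_block (F : fieldType) (gT : finGroupType) (G : {group gT}) m n
    (r1 : gT -> 'M[F]_m) (r2 : gT -> 'M[F]_n) :
  mx_repr G r1 -> mx_repr G r2 -> mx_repr G (fun g => block_mx (r1 g) 0 0 (r2 g)).
Proof.
move=> [r11 r1M] [r21 r2M]; split=> [|g h Gg Gh]; first by rewrite r11 r21 -scalar_mx_block.
by rewrite mulmx_block !mulmx0 !mul0mx !addr0 !add0r r1M ?r2M.
Qed.

Lemma mx_repr_map (F K : fieldType) (f : {rmorphism F -> K}) (gT : finGroupType)
    (G : {group gT}) n (r : gT -> 'M[F]_n) :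
  mx_repr G r -> mx_repr G (fun g => map_mx f (r g)).
Proof.
by move=> [r1 rM]; split=> [|g h Gg Gh]; rewrite ?r1 ?map_mx1 ?rM ?map_mxM.
Qed.

(** After extension of scalars [r] becomes conjugate to [u], and [map_mx f] is injective, so
    multiplicativity descends to [F]. *)
Lemma mx_repr_descent (F K : fieldType) (f : {rmorphism F -> K}) (gT : finGroupType)
    (G : {group gT}) n (r : gT -> 'M[F]_n) (u : gT -> 'M[K]_n) P :
  P \in unitmx -> {in G, forall g, map_mx f (r g) *m P = P *m u g} ->
  mx_repr G u -> mx_repr G r.
Proof.
move=> uP ru [u1 uM].
have edge_refs g : g \in G -> map_mx f (r g) = P *m u g *m invmx P.
  by move=> Gg; rewrite -ru // mulmxK.
split=> [|g h Gg Gh]; apply: (@map_mx_inj _ _ f).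
  by rewrite edge_refs // u1 mulmx1 mulmxV // map_mx1.
by rewrite map_mxM !edge_refs ?groupM // uM // !mulmxA mulmxKV.
Qed.

Lemma mx_faithfulP (F : fieldType) (gT : finGroupType) (G : {group gT}) n
    (rG : mx_representation F G n) :
  (forall g, g \in G -> rG g = 1%:M -> g = 1%g) -> mx_faithful rG.
Proof.
move=> inj; apply/subsetP=> g; rewrite inE mul1mx => /andP[Gg /eqP g1].
by rewrite inE (inj g).
Qed.

(** * Real form of a complex representation plus its conjugate *)

Section Realification.

Variables (R : rcfType) (m n : nat).
Local Notation rc := (real_complex R).
Local Notation I := ('i%C : R[i]).

(** The direct sum of [A] and the real form [[X, Y], [-Y, X]] of B = X + iY, bracketed so that the
    last block can become the conjugate of [B]. *)
Definition realify (A : 'M[R]_m) (B : 'M[R[i]]_n) : 'M[R]_(m + n + n) :=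
  let X := map_mx (@complex.Re R) B in let Y := map_mx (@complex.Im R) B in
  block_mx (block_mx A 0 0 X) (col_mx 0 Y) (row_mx 0 (- Y)) X.

(** The block columns (1, i) and (1, -i) are those on which [[X, Y], [-Y, X]] acts as X + iY and X -
    iY. *)
Definition realify_basis : 'M[R[i]]_(m + n + n) :=
  block_mx (block_mx 1%:M 0 0 1%:M) (col_mx 0 1%:M) (row_mx 0 I%:M) (- I%:M).

Lemma realify_basis_unit : realify_basis \in unitmx.
Proof.
(* The inverse of [[1, 1], [i, -i]] is half of [[1, -i], [1, i]]. *)
pose h : R[i] := 2%:R^-1.
pose Q : 'M[R[i]]_(m + n + n) :=
  block_mx (block_mx 1%:M 0 0 h%:M) (col_mx 0 (- (h * I))%:M)
           (row_mx 0 h%:M) (h * I)%:M.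
have hh : h + h = 1 by rewrite -mulr2n -[h *+ 2]mulr_natl mulfV // pnatr_eq0.
have II : I * I = -1 by rewrite -expr2 sqr_i.
suff /mulmx1_unit[] : realify_basis *m Q = 1%:M by [].
rewrite /realify_basis /Q !mulmx_block.
rewrite !(mul_row_block, mul_block_col, mul_row_col, mul_col_row, mul_col_mx, mul_mx_row).
rewrite !(mulmx0, mul0mx, mulmx1, mul1mx, add0r, addr0, mulNmx, =^~ scalar_mxM).
rewrite !(add_block_mx, add_col_mx, add_row_mx, opp_row_mx, add0r, addr0).
rewrite mulrN mulrCA II mulrN1 opprK !raddfN /= addNr subrr opprK -raddfD /= hh.
by rewrite col_mx0 row_mx0 -!scalar_mx_block.
Qed.

Lemma realifyE A B :
  map_mx rc (realify A B) *m realify_basis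
    = realify_basis *m block_mx (block_mx (map_mx rc A) 0 0 B) 0 0 (map_mx conjc B).
Proof.
have BE : B = map_mx rc (map_mx (@complex.Re R) B) + I *: map_mx rc (map_mx (@complex.Im R) B).
  apply/matrixP=> i j; rewrite !mxE; case: (B i j) => a b; apply/eqP.
  by rewrite eq_complex /= !(mul0r, mul1r, mulr0, subr0, sub0r, oppr0, addr0, add0r) !eqxx.
have CE : map_mx conjc B
    = map_mx rc (map_mx (@complex.Re R) B) - I *: map_mx rc (map_mx (@complex.Im R) B).
  apply/matrixP=> i j; rewrite !mxE; case: (B i j) => a b; apply/eqP.
  by rewrite eq_complex /= !(mul0r, mul1r, mulr0, subr0, sub0r, oppr0, addr0, add0r) !eqxx.
have II : I * I = -1 by rewrite -expr2 sqr_i.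
rewrite /realify CE.
move: (map_mx (@complex.Re R) B) (map_mx (@complex.Im R) B) BE => X Y BE {CE}.
have IB : I *: B = - map_mx rc Y + I *: map_mx rc X.
  by rewrite BE scalerDr scalerA II scaleN1r addrC.
rewrite !(map_block_mx, map_row_mx, map_col_mx) !map_mx0 map_mxN.
rewrite !mulmx_block.
rewrite !(mul_row_block, mul_block_col, mul_row_col, mul_col_row, mul_col_mx, mul_mx_row).
rewrite !(mulmx0, mul0mx, mulmx1, mul1mx, add0r, addr0, mulNmx, mulmxN,
          mul_mx_scalar, mul_scalar_mx).
rewrite !(add_block_mx, add_col_mx, add_row_mx, opp_row_mx, add0r, addr0).
rewrite -BE IB scalerBr scalerA II scaleN1r opprB.
by [].
Qed.

End Realification.

Lemma faithful_reps (R : rcfType) :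
  exists (Vr : mx_representation R G3 12)
         (Vn : mx_representation R[i] G3 8)
         (V : mx_representation R[i] G3 (12 + 8)),
    mx_faithful V /\
    (forall g, g \in G3 ->
       V g = block_mx (map_mx (real_complex R) (Vr g)) 0 0 (Vn g)) /\
    exists W : mx_representation R G3 (12 + 8 + 8),
      mx_faithful W /\
      exists P : 'M[R[i]]_(12 + 8 + 8),
        P \in unitmx /\
        forall g, g \in G3 ->
          map_mx (real_complex R) (W g) *m P
          = P *m block_mx (V g) 0 0 (map_mx conjc (Vn g)).
Proof.
have [z pz] := prim_root_exists R[i] (isT : (0 < 3)%N).
pose Vr := cubelet_repr (prim_root_opp1 R) edge_blocks.
pose Vn := cubelet_repr pz corner_blocks.
have reprP F n (r : mx_representation F G3 n) : mx_repr G3 r by case: r.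
pose Vblock g := block_mx (map_mx (real_complex R) (Vr g)) 0 0 (Vn g).
have reprV : mx_repr G3 Vblock.
  exact: mx_repr_block (mx_repr_map _ (reprP _ _ Vr)) (reprP _ _ Vn).
have V1 g : g \in G3 -> Vblock g = 1%:M -> g = 1%g.
  rewrite scalar_mx_block => Gg /eq_block_mx[r1 _ _ n1].
  apply: (cubelet_faithful (p1 := pz) (p2 := prim_root_opp1 R) Gg n1).
  by apply: (@map_mx_inj _ _ (real_complex R)); rewrite r1 map_mx1.
pose U g := block_mx (Vblock g) 0 0 (map_mx conjc (Vn g)).
have WU g : map_mx (real_complex R) (realify (Vr g) (Vn g)) *m realify_basis R 12 8
            = realify_basis R 12 8 *m U g by exact: realifyE.
have uP := realify_basis_unit R 12 8.
(* Multiplicativity of the real matrices comes from the complex block sum to which they are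
   conjugate. *)
have reprW : mx_repr G3 (fun g => realify (Vr g) (Vn g)).
  apply: (mx_repr_descent uP (fun g _ => WU g)).
  exact: mx_repr_block reprV (mx_repr_map _ (reprP _ _ Vn)).
exists Vr, Vn, (MxRepresentation reprV); split; first exact: mx_faithfulP.
split=> //; exists (MxRepresentation reprW); split; last first.
  by exists (realify_basis R 12 8); split=> [|g _]; [exact: uP | exact: WU].
apply: mx_faithfulP => g Gg /= W1; apply: (V1 _ Gg).
have : U g = 1%:M by rewrite -[U g](mulKmx uP) -WU W1 map_mx1 mul1mx mulVmx.
by rewrite [RHS]scalar_mx_block => /eq_block_mx[].
Qed.

(** * Lower bounds *)

Lemma all_valid :
  [/\ all valid corner_twists, all valid edge_flips, all valid corner_cycles
    & all valid edge_cycles].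
Proof. by have /and5P[] := valid_words. Qed.

Definition twist_group : {group {perm sticker}} :=
  <<[set x in [seq wperm w | w <- corner_twists ++ edge_flips]]>>%G.

Lemma valid_tCE : all valid (corner_twists ++ edge_flips).
Proof. by rewrite all_cat; case: all_valid => -> ->. Qed.

Lemma twist_group_sub : twist_group \subset G3.
Proof.
rewrite gen_subG; apply/subsetP=> x; rewrite inE => /mapP[w wT ->].
exact/wperm_G3/(allP valid_tCE).
Qed.

Lemma twist_group_abelian : abelian twist_group.
Proof.
rewrite abelian_gen; apply/centsP=> x; rewrite inE => /mapP[v vT ->].
move=> y; rewrite inE => /mapP[w wT ->].
apply: commuting_tablesP; rewrite ?(allP valid_tCE) //.
have /allrelP := twists_commute; apply; exact: map_f.
Qed.

Lemma mem_twist_group T i :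
  {subset T <= corner_twists ++ edge_flips} -> wperm (twist T i) \in twist_group.
Proof.
move=> sT; have [lti|gei] := ltnP i (size T); last first.
  by rewrite /twist nth_default // /wperm big_nil group1.
by apply: mem_gen; rewrite inE; apply/map_f/sT/mem_nth.
Qed.

Lemma mem_corner_twist i : wperm (twist corner_twists i) \in twist_group.
Proof. by apply: mem_twist_group => w wT; rewrite mem_cat wT. Qed.

Lemma mem_edge_flip i : wperm (twist edge_flips i) \in twist_group.
Proof. by apply: mem_twist_group => w wT; rewrite mem_cat wT orbT. Qed.

Lemma corner_twist_order i : (wperm (twist corner_twists i) ^+ 3 = 1)%g.
Proof.
have [lti|gei] := ltnP i (size corner_twists); last first.
  by rewrite /twist nth_default // /wperm big_nil expg1n.
have vw : valid (twist corner_twists i) by apply: valid_twist; case: all_valid.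
have tt := tabulates_word vw.
apply: tabulates_inj tabulates1; rewrite !expgS expg0 mulg1 mulgA.
have mt : wtable (twist corner_twists i) \in tables corner_twists by apply/map_f/mem_nth.
have /andP[/allP/(_ _ mt)/eqP <- _] := twists_order.
exact: tabulates_comp (tabulates_comp tt tt) tt.
Qed.

Lemma edge_flip_order i : (wperm (twist edge_flips i) ^+ 2 = 1)%g.
Proof.
have [lti|gei] := ltnP i (size edge_flips); last first.
  by rewrite /twist nth_default // /wperm big_nil expg1n.
have vw : valid (twist edge_flips i) by apply: valid_twist; case: all_valid.
have tt := tabulates_word vw.
apply: tabulates_inj tabulates1; rewrite !expgS expg0 mulg1.
have mt : wtable (twist edge_flips i) \in tables edge_flips by apply/map_f/mem_nth.
have /andP[_ /allP/(_ _ mt)/eqP <-] := twists_order.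
by apply: tabulates_comp.
Qed.

Lemma corner_cycle_conj c i : c \in corner_cycles -> (i < size corner_twists)%N ->
  (wperm c * wperm (twist corner_twists i)
   = wperm (twist corner_twists (nth 0 (source corner_refs c) i)) *
     wperm (twist corner_twists (nth 0 (source corner_refs c) 0)) ^+ 2 * wperm c)%g.
Proof.
case: all_valid => vC _ vc _ cc lti.
have /allP/(_ c cc)/andP[rel _] := corner_cycles_rel.
exact: (conj_relP (allP vc c cc) vC rel lti).
Qed.

Lemma edge_cycle_conj c i : c \in edge_cycles -> (i < size edge_flips)%N ->
  (wperm c * wperm (twist edge_flips i)
   = wperm (twist edge_flips (nth 0 (source edge_refs c) i)) *
     wperm (twist edge_flips (nth 0 (source edge_refs c) 0)) ^+ 1 * wperm c)%g.
Proof.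
case: all_valid => _ vE _ ve ce lti.
have /allP/(_ c ce)/andP[rel _] := edge_cycles_rel.
exact: (conj_relP (allP ve c ce) vE rel lti).
Qed.

Lemma corner_cycle_commute c i : c \in corner_cycles ->
  commute (wperm c) (wperm (twist edge_flips i)).
Proof.
move=> cc; case: all_valid => _ vE vc _.
have [lti|gei] := ltnP i (size edge_flips); last first.
  by rewrite /twist nth_default // /wperm big_nil; apply: commute1.
have /allP/(_ c cc)/andP[_ /allP com] := corner_cycles_rel.
apply: commuting_tablesP (allP vc c cc) (valid_twist i vE) _.
by apply: com; apply: map_f; apply: mem_nth.
Qed.

Lemma edge_cycle_commute c i : c \in edge_cycles ->
  commute (wperm c) (wperm (twist corner_twists i)).
Proof.
move=> ce; case: all_valid => vC _ _ ve.
have [lti|gei] := ltnP i (size corner_twists); last first.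
  by rewrite /twist nth_default // /wperm big_nil; apply: commute1.
have /allP/(_ c ce)/andP[_ /allP com] := edge_cycles_rel.
apply: commuting_tablesP (allP ve c ce) (valid_twist i vC) _.
by apply: com; apply: map_f; apply: mem_nth.
Qed.

Lemma corner_twist_neq1 : wperm (twist corner_twists 1) != 1%g.
Proof. by apply: wtable_neq1 twist_table; apply: valid_twist; case: all_valid. Qed.

Lemma superflip_neq1 : wperm (flatten edge_flips) != 1%g.
Proof.
by apply: wtable_neq1 superflip_table; vm_compute.
Qed.

(** * Exponents of roots of unity *)

Section DiscreteLog.

Variables (F : fieldType) (d : nat) (z : F).
Hypothesis prim_z : d.-primitive_root z.

Definition dlog (x : F) : nat := index x [seq z ^+ i | i <- iota 0 d].

Lemma dlog_prim i : (i < d)%N -> dlog (z ^+ i) = i.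
Proof.
move=> ltid; rewrite /dlog; have := @index_uniq _ 0 i [seq z ^+ i | i <- iota 0 d].
rewrite size_map size_iota (nth_map 0%N) ?size_iota // nth_iota // add0n => -> //.
rewrite map_inj_in_uniq ?iota_uniq // => j k; rewrite !mem_iota /= => ltj ltk /eqP.
by rewrite (eq_prim_root_expr prim_z) !modn_small // => /eqP.
Qed.

Lemma dlogK x : x ^+ d = 1 -> (dlog x < d)%N /\ z ^+ dlog x = x.
Proof. by move=> /(prim_rootP prim_z)[i ->]; rewrite dlog_prim. Qed.

Lemma dlog1 : dlog 1 = 0%N.
Proof. by rewrite -(expr0 z) dlog_prim // (prim_order_gt0 prim_z). Qed.

(** As [y ^+ d.-1] is the inverse of [y], exponents are subtracted; [e] is less than 2d, so a single
    reduction suffices, in the form used by [move]. *)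
Lemma dlog_div x y : x ^+ d = 1 -> y ^+ d = 1 ->
  let e := (dlog x + (d - dlog y))%N in
  dlog (x * y ^+ d.-1) = if (e < d)%N then e else (e - d)%N.
Proof.
move=> xd yd e; have [ltx {1}<-] := dlogK xd; have [lty Ey] := dlogK yd.
have d0 := prim_order_gt0 prim_z.
have y0 : y != 0.
  apply/eqP=> y0; have /eqP := yd.
  by rewrite y0 expr0n eqn0Ngt d0 eq_sym oner_eq0.
have -> : y ^+ d.-1 = z ^+ (d - dlog y).
  apply: (mulIf y0); rewrite -exprSr prednK // yd -{2}Ey -exprD subnK; last exact: ltnW.
  by rewrite (prim_expr_order prim_z).
rewrite -exprD -/e; case: ltnP => [|led]; first exact: dlog_prim.
rewrite -[in LHS](subnK led) exprD (prim_expr_order prim_z) mulr1 dlog_prim //.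
rewrite /e; lia.
Qed.

Lemma dlog_inv x : x ^+ d = 1 ->
  dlog (x ^+ d.-1) = if dlog x == 0%N then 0%N else (d - dlog x)%N.
Proof.
move=> xd; have := dlog_div (expr1n F d) xd; rewrite mul1r dlog1 add0n => ->.
have [ltx _] := dlogK xd; case: eqP => [->|/eqP x0]; first by rewrite subn0 ltnn subnn.
by rewrite ltn_subrL lt0n x0 (prim_order_gt0 prim_z).
Qed.

End DiscreteLog.

(** * Weights of the twist group, their symmetries and their number *)

Section Weights.

Variables (F : numClosedFieldType) (n : nat) (rG : mx_representation F G3 n).
Variable wt : 'I_n -> {perm sticker} -> F.
Local Notation A := twist_group.
Hypothesis wt_vec : forall k, exists2 v : 'rV_n, v != 0 &
  {in A, forall x, v *m rG x = wt k x *: v}.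
Hypothesis vec_wt : forall (B : {pred {perm sticker}}) chi (v : 'rV_n),
  {subset B <= A} -> v != 0 -> {in B, forall x, v *m rG x = chi x *: v} ->
  exists k, {in B, forall x, wt k x = chi x}.

Let AG x : x \in A -> x \in G3. Proof. exact: (subsetP twist_group_sub). Qed.

Lemma weightM k : {in A &, {morph wt k : x y / (x * y)%g >-> x * y}}.
Proof.
move=> x y Ax Ay; have [v v0 vE] := wt_vec k; have Axy := groupM Ax Ay.
apply/eqP; rewrite -subr_eq0; have : (wt k (x * y)%g - wt k x * wt k y) *: v == 0.
  rewrite scalerBl -vE // repr_mxM ?AG // mulmxA vE // -scalemxAl vE // scalerA.
  by rewrite subrr.
by rewrite scaler_eq0 (negbTE v0) orbF.
Qed.

Lemma weight1 k : wt k 1%g = 1.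
Proof.
have [v v0 vE] := wt_vec k; apply/eqP; rewrite -subr_eq0.
have : (wt k 1%g - 1) *: v == 0 by rewrite scalerBl -vE // repr_mx1 mulmx1 scale1r subrr.
by rewrite scaler_eq0 (negbTE v0) orbF.
Qed.

Lemma weightX k m : {in A, {morph wt k : x / (x ^+ m)%g >-> x ^+ m}}.
Proof.
move=> x Ax; elim: m => [|m IH]; first by rewrite weight1.
by rewrite expgS exprS weightM ?groupX // IH.
Qed.

(** If [v] has weight [wt k], then [v *m rG g] is an eigenvector of every [x] in [A] with g x g^-1
    in [A], and its eigenvalue is that of g x g^-1 on [v]. *)
Lemma weight_conj k g : g \in G3 ->
  exists k', {in A &, forall x y, (g * x = y * g)%g -> wt k' x = wt k y}.
Proof.
move=> Gg; have [v v0 vE] := wt_vec k.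
pose B := [pred x in A | (x ^ g^-1)%g \in A].
have vg0 : v *m rG g != 0.
  by apply: contraNneq v0 => vg; rewrite -(repr_mxK rG Gg v) vg mul0mx.
have [|x /andP[Ax Ay]|k' k'E] := vec_wt (B := B) (chi := fun x => wt k (x ^ g^-1)%g) _ vg0.
- by move=> x /andP[].
- rewrite -mulmxA -repr_mxM ?(AG Ax) // (_ : (g * x = x ^ g^-1 * g)%g); last first.
    by rewrite conjgE invgK !mulgA mulgKV.
  by rewrite repr_mxM ?(AG Ay) // mulmxA vE // scalemxAl.
exists k' => x y Ax Ay gxy.
have <- : (x ^ g^-1 = y)%g by rewrite conjgE invgK mulgA gxy mulgK.
by apply: k'E; rewrite inE Ax /= conjgE invgK mulgA gxy mulgK.
Qed.

Definition signature d (z : F) (T : seq word) k : seq nat :=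
  [seq dlog d z (wt k (wperm w)) | w <- T].

Lemma nth_signature d (z : F) T k i : d.-primitive_root z ->
  nth 0%N (signature d z T k) i = dlog d z (wt k (wperm (twist T i))).
Proof.
move=> pz; have [lti|gei] := ltnP i (size T); first by rewrite (nth_map [::]).
by rewrite /twist !nth_default ?size_map // /wperm big_nil weight1 (dlog1 pz).
Qed.

Lemma signature_move d (z : F) T k k' p : d.-primitive_root z -> size p = size T ->
    (forall i, wperm (twist T i) \in A) -> (forall i, (wperm (twist T i) ^+ d = 1)%g) ->
    (forall i, (i < size T)%N -> wt k' (wperm (twist T i)) =
       wt k (wperm (twist T (nth 0%N p i)) * wperm (twist T (nth 0%N p 0)) ^+ d.-1)%g) ->
  signature d z T k' = move d p (signature d z T k).
Proof.
move=> pz sz AT Td E; apply: (@eq_from_nth _ 0%N); rewrite !size_map ?sz // => i lti.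
rewrite nth_signature // E // weightM ?groupX ?AT // weightX ?AT //.
have wd j : wt k (wperm (twist T j)) ^+ d = 1 by rewrite -weightX ?AT // Td weight1.
by rewrite (dlog_div pz (wd _) (wd _)) (nth_map 0%N) ?sz // !nth_signature.
Qed.

Variables z2 z3 : F.
Hypotheses (pz2 : 2.-primitive_root z2) (pz3 : 3.-primitive_root z3).

Lemma signature_corner_cycle k c : c \in corner_cycles -> exists k',
  signature 3 z3 corner_twists k'
    = move 3 (source corner_refs c) (signature 3 z3 corner_twists k) /\
  signature 2 z2 edge_flips k' = signature 2 z2 edge_flips k.
Proof.
move=> cc; have vc : valid c by case: all_valid => _ _ /allP/(_ _ cc).
have [k' k'E] := weight_conj k (wperm_G3 vc).
exists k'; split.
  apply: signature_move pz3 _ mem_corner_twist corner_twist_order _; first by rewrite !size_map.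
  by move=> i lti; apply: k'E; rewrite ?groupM ?groupX ?mem_corner_twist // corner_cycle_conj.
apply: (@eq_from_nth _ 0%N); rewrite !size_map // => i lti; rewrite !nth_signature //.
by congr dlog; apply: k'E; rewrite ?mem_edge_flip //; apply: corner_cycle_commute.
Qed.

Lemma signature_edge_cycle k c : c \in edge_cycles -> exists k',
  signature 2 z2 edge_flips k' = move 2 (source edge_refs c) (signature 2 z2 edge_flips k) /\
  signature 3 z3 corner_twists k' = signature 3 z3 corner_twists k.
Proof.
move=> ce; have vc : valid c by case: all_valid => _ _ _ /allP/(_ _ ce).
have [k' k'E] := weight_conj k (wperm_G3 vc).
exists k'; split.
  apply: signature_move pz2 _ mem_edge_flip edge_flip_order _; first by rewrite !size_map.
  by move=> i lti; apply: k'E; rewrite ?groupM ?groupX ?mem_edge_flip // edge_cycle_conj.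
apply: (@eq_from_nth _ 0%N); rewrite !size_map // => i lti; rewrite !nth_signature //.
by congr dlog; apply: k'E; rewrite ?mem_corner_twist //; apply: edge_cycle_commute.
Qed.

Lemma mem_flatten_word T :
  {in T, forall w, wperm w \in A} -> wperm (flatten T) \in A.
Proof.
elim: T => [|w T IH] AT; first by rewrite /wperm big_nil group1.
rewrite /= wperm_cat; apply: groupM; first by apply: AT; rewrite mem_head.
by apply: IH => w' w'T; apply: AT; rewrite inE w'T orbT.
Qed.

(** Applied to the superflip, this reads its weight off the parity of the flip exponents. *)
Lemma weight_flatten d (z : F) T k : d.-primitive_root z ->
    {in T, forall w, wperm w \in A} -> {in T, forall w, (wperm w ^+ d = 1)%g} ->
  wt k (wperm (flatten T)) = z ^+ sumn (signature d z T k).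
Proof.
move=> pz; elim: T => [|w T IH] AT Td; first by rewrite /wperm big_nil weight1.
have Aw : wperm w \in A by apply: AT; rewrite mem_head.
have sT : {subset T <= w :: T} by move=> w' w'T; rewrite inE w'T orbT.
have AT' := mem_flatten_word (sub_in1 sT AT).
rewrite /= wperm_cat weightM // (IH (sub_in1 sT AT) (sub_in1 sT Td)) exprD; congr (_ * _).
have wd : wt k (wperm w) ^+ d = 1 by rewrite -weightX // Td ?weight1 ?mem_head.
by have [_ ->] := dlogK pz wd.
Qed.

Lemma signature_twists d (z : F) b gs k : d.-primitive_root z ->
    (forall i, wperm (twist (twists b gs) i) \in A) ->
    (forall i, (wperm (twist (twists b gs) i) ^+ d = 1)%g) ->
  exists a, [/\ signature d z (twists b gs) k = 0%N :: a, size a = size gs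
               & all (fun i => (i < d)%N) a].
Proof.
move=> pz TA Td; exists (signature d z [seq wconj b g | g <- gs] k); split.
- by rewrite [LHS]/= /wperm big_nil weight1 (dlog1 pz).
- by rewrite !size_map.
apply/(all_nthP 0%N) => i lti.
rewrite -[nth _ _ _]/(nth 0%N (signature d z (twists b gs) k) i.+1) nth_signature //.
by have [] := dlogK pz (_ : wt k (wperm (twist (twists b gs) i.+1)) ^+ d = 1);
  rewrite // -weightX ?TA // Td weight1.
Qed.

(** There are [n] weights counted with multiplicity, so it suffices to exhibit N + 12 distinct
    signatures. [N] is 8 in the complex case and 16 in the real one. *)
Lemma weights_bound N (ms : seq (option (seq nat))) :
    large_corner_orbits N ms -> (N + 12 <= N * 12)%N ->
    (forall o k, o \in ms -> exists k',
       signature 3 z3 corner_twists k' = omove 3 o (signature 3 z3 corner_twists k) /\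
       signature 2 z2 edge_flips k' = signature 2 z2 edge_flips k) ->
    {in A, forall x, (forall k, wt k x = 1) -> x = 1%g} ->
  (N + 12 <= n)%N.
Proof.
move=> orbC leN moveC faith.
pose sg k := (signature 3 z3 corner_twists k, signature 2 z2 edge_flips k).
pose S := [seq sg k | k <- enum 'I_n].
have sizeS : size S = n by rewrite size_map size_enum_ord.
have memS k : sg k \in S by rewrite map_f ?mem_enum.
have SP a b : (a, b) \in S ->
    exists k, a = signature 3 z3 corner_twists k /\ b = signature 2 z2 edge_flips k.
  by move=> /mapP[k _ E]; exists k; split;
    [exact: (congr1 (fun p => p.1) E) | exact: (congr1 (fun p => p.2) E)].
have closC a b o : o \in ms -> (a, b) \in S -> (omove 3 o a, b) \in S.
  move=> om /SP[k [-> ->]]; have [k' [E1 E2]] := moveC o k om.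
  by rewrite -E1 -E2; apply: memS.
have closE a b o : o \in edge_moves -> (a, b) \in S -> (a, omove 2 o b) \in S.
  move=> /mapP[c cc ->] /SP[k [-> ->]].
  have [k' [E1 E2]] := signature_edge_cycle k cc.
  by rewrite -[omove _ _ _]E1 -E2; apply: memS.
have wt_neq x : x \in A -> x != 1%g -> exists k, wt k x != 1.
  move=> Ax x1; apply/existsP; apply: contraR x1.
  by rewrite negb_exists => /forallP w1; apply/eqP/faith => // k; apply/eqP; rewrite -[_ == _]negbK.
pose oC a := explore (omove 3) ms N N a.
pose oE b := explore (omove 2) edge_moves 12 12 b.
have oCP a b : (a, b) \in S -> uniq (oC a) /\ {in oC a, forall a', (a', b) \in S}.
  by move=> ab; apply: (@exploreP _ _ _ _ _ _ _ (fun a' => (a', b) \in S)) => // o y om;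
    apply: closC.
have oEP a b : (a, b) \in S -> uniq (oE b) /\ {in oE b, forall b', (a, b') \in S}.
  by move=> ab; apply: (@exploreP _ _ _ _ _ _ _ (fun b' => (a, b') \in S)) => // o y om;
    apply: closE.
have sizeC a b : (a, b) \in S -> a != nseq 8 0%N ->
    (N <= size (oC a))%N /\ nseq 8 0%N \notin oC a.
  move=> /SP[k [-> _]] k0.
  have [a' [Ea sza' lta']] :=
    signature_twists k pz3 mem_corner_twist corner_twist_order.
  have a'E : a' \in exponents 3 7 by rewrite -[7%N]sza'; apply: mem_exponents.
  have := allP orbC a' a'E; rewrite -Ea => /orP[/eqP a'0|/andP[]] //.
  by case/eqP: k0; rewrite Ea a'0.
have sizeE a b : (a, b) \in S -> odd (sumn b) -> (12 <= size (oE b))%N.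
  move=> /SP[k [_ ->]] kodd.
  have [b' [Eb szb' ltb']] :=
    signature_twists k pz2 mem_edge_flip edge_flip_order.
  have b'E : b' \in exponents 2 11 by rewrite -[11%N]szb'; apply: mem_exponents.
  have := implyP (allP edge_orbits b' b'E); rewrite -Eb; apply.
  by move: kodd; rewrite Eb.
have [a1 [b1 [ab1 a1P]]] : exists a b, (a, b) \in S /\ a != nseq 8 0%N.
  have [k kP] := wt_neq _ (mem_corner_twist 1) corner_twist_neq1.
  exists (signature 3 z3 corner_twists k), (signature 2 z2 edge_flips k); split; first exact: memS.
  (* If all exponents vanished, the weight of the twist would be [z3 ^+ 0], that is 1. *)
  apply: contraNneq kP => a0; have := nth_signature corner_twists k 1 pz3; rewrite a0 => d0.
  have [|_ <-] := dlogK pz3 (x := wt k (wperm (twist corner_twists 1))); last by rewrite -d0.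
  by rewrite -weightX ?mem_corner_twist // corner_twist_order weight1.
have [a2 [b2 [ab2 b2P]]] : exists a b, (a, b) \in S /\ odd (sumn b).
  have tE_i w : w \in edge_flips -> w = twist edge_flips (index w edge_flips).
    by move=> wT; rewrite /twist nth_index.
  have tA : {in edge_flips, forall w, wperm w \in A}.
    by move=> w /tE_i ->; apply: mem_edge_flip.
  have tO : {in edge_flips, forall w, (wperm w ^+ 2 = 1)%g}.
    by move=> w /tE_i ->; apply: edge_flip_order.
  have [k kP] := wt_neq _ (mem_flatten_word tA) superflip_neq1.
  exists (signature 3 z3 corner_twists k), (signature 2 z2 edge_flips k); split; first exact: memS.
  (* An even sum of exponents would give the superflip weight 1. *)
  apply: contraR kP => /negbTE even; rewrite (weight_flatten k pz2 tA tO).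
  rewrite -[sumn _]odd_double_half even add0n -mul2n exprM.
  by rewrite (prim_expr_order pz2) expr1n.
rewrite -sizeS; have [uE EP] := oEP _ _ ab2; have NE := sizeE _ _ ab2 b2P.
(* The searches and the list [S] become opaque; the count rests on the facts collected about
   them. *)
clear sizeE sizeS memS SP closC closE.
move: oC oE uE EP NE oCP oEP sizeC => oC oE uE EP NE oCP oEP sizeC.
move: S ab1 ab2 uE EP NE oCP oEP sizeC  => S ab1 ab2 uE EP NE oCP oEP sizeC.
(* If the second weight is non-trivial on corners, moving corners and edges independently gives a
   full product of orbits. *)
have [a20 | a20] := eqVneq a2 (nseq 8 0%N); last first.
  have [NC _] := sizeC _ _ ab2 a20; have [uC CP] := oCP _ _ ab2.
  apply: leq_trans leN _; apply: leq_trans (leq_mul NC NE) _.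
  rewrite -(size_allpairs pair); apply: uniq_leq_size.
    by apply: allpairs_uniq => // -[? ?] [? ?].
  move=> _ /allpairsP[[a b] /= [aC bE ->]].
  by have [_] := oEP _ _ (CP _ aC); apply.
(* Here [a2] is zero while the corner orbit of [a1] avoids zero, so the two families of pairs are
   disjoint. *)
have [NC C0] := sizeC _ _ ab1 a1P; have [uC CP] := oCP _ _ ab1.
apply: leq_trans (leq_add NC NE) _.
have -> : (size (oC a1) + size (oE b2))%N
    = size ([seq (a, b1) | a <- oC a1] ++ [seq (a2, b) | b <- oE b2]).
  by rewrite size_cat !size_map.
apply: uniq_leq_size.
  rewrite cat_uniq !map_inj_uniq ?uC ?uE ?andbT /=; try by move=> ? ? [].
  apply/hasPn=> _ /mapP[b _ ->]; apply: contra C0 => /mapP[a aC [Ea _]].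
  by rewrite -a20 Ea.
by move=> x; rewrite mem_cat => /orP[] /mapP[y yo ->]; [apply: CP | apply: EP].
Qed.

End Weights.

Lemma complex_lower_bound (F : numClosedFieldType) n (rG : mx_representation F G3 n) :
  mx_faithful rG -> (20 <= n)%N.
Proof.
move=> inj; have [z2 pz2] := prim_root_exists F (isT : (0 < 2)%N).
have [z3 pz3] := prim_root_exists F (isT : (0 < 3)%N).
have [wt [wt_vec vec_wt wt1]] := abelian_weights rG twist_group_sub twist_group_abelian.
apply: (weights_bound wt_vec vec_wt pz2 pz3 corner_orbits) => // [o k /mapP[c cc ->]|x Ax x1].
  exact: signature_corner_cycle.
apply: (mx_faithful_inj inj); rewrite ?group1 ?(subsetP twist_group_sub) //.
by rewrite repr_mx1; apply: wt1.
Qed.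

(** A root of unity has modulus 1, so its conjugate is its inverse. *)
Lemma conjc_unity_root (R : rcfType) d (x : R[i]) :
  (0 < d)%N -> x ^+ d = 1 -> conjc x = x ^+ d.-1.
Proof.
move=> d0 xd; have x0 : x != 0.
  by apply/eqP=> x0; move/eqP: xd; rewrite x0 expr0n eqn0Ngt d0 eq_sym oner_eq0.
apply: (mulfI x0); rewrite -exprS prednK // xd.
have nx : `|x| = 1 by apply/eqP; rewrite -(pexpr_eq1 d0) // -normrX xd normr1.
by rewrite -[LHS](normCK x) nx expr1n.
Qed.

(** Over the complex numbers the matrices stay real, so conjugating an eigenvector conjugates its
    weight. The weights are therefore stable under inversion, which doubles the corner orbits. *)
Lemma real_lower_bound (R : rcfType) n (rG : mx_representation R G3 n) :
  mx_faithful rG -> (28 <= n)%N.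
Proof.
rewrite -(map_mx_faithful (real_complex R)) => inj.
have [z2 pz2] := prim_root_exists R[i] (isT : (0 < 2)%N).
have [z3 pz3] := prim_root_exists R[i] (isT : (0 < 3)%N).
have [wt [wt_vec vec_wt wt1]] :=
  abelian_weights (map_repr (real_complex R) rG) twist_group_sub twist_group_abelian.
apply: (weights_bound wt_vec vec_wt pz2 pz3 corner_opp_orbits) => // [o k|x Ax x1]; last first.
  apply: (mx_faithful_inj inj); rewrite ?group1 ?(subsetP twist_group_sub) //.
  by rewrite [RHS]repr_mx1; apply: wt1.
rewrite mem_rcons inE => /predU1P[->|/mapP[c cc ->]]; last exact: signature_corner_cycle.
have [v v0 vE] := wt_vec k.
have cv0 : map_mx conjc v != 0.
  by apply: contraNneq v0 => cv; rewrite -(map_mx_eq0 conjc) cv.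
have [//||k' k'E] := vec_wt (mem twist_group) (fun x => conjc (wt k x)) _ _ cv0.
  move=> x Ax; have := congr1 (map_mx conjc) (vE x Ax).
  rewrite map_mxM map_mxZ => E; apply: (etrans _ E); congr (_ *m _).
  by apply/matrixP=> i j; rewrite [RHS]mxE map_reprE mxE; apply: esym (conjc_real _).
exists k'; split.
  rewrite /omove /opposite /signature -[RHS]map_comp; apply/eq_in_map => w wT /=.
  have Aw : wperm w \in twist_group by rewrite -(nth_index [::] wT) mem_corner_twist.
  have wd : wt k (wperm w) ^+ 3 = 1.
    by rewrite -(weightX wt_vec) // -(nth_index [::] wT) corner_twist_order (weight1 wt_vec).
  by rewrite k'E // (conjc_unity_root _ wd) // (dlog_inv pz3 wd).
(* Flip weights are square roots of 1, hence fixed by conjugation. *)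
rewrite /signature; apply/eq_in_map => w wT; congr dlog.
have Aw : wperm w \in twist_group by rewrite -(nth_index [::] wT) mem_edge_flip.
have wd : wt k (wperm w) ^+ 2 = 1.
  by rewrite -(weightX wt_vec) // -(nth_index [::] wT) edge_flip_order (weight1 wt_vec).
by rewrite k'E // (conjc_unity_root _ wd).
Qed.

(* R : realType models the real numbers, R[i] the complex numbers. *)
Theorem theorem5p2 (R : realType) :
  mdim_is R[i] G3 20 /\ mdim_is R G3 28 /\
  exists (Vr : mx_representation R G3 12)
         (Vn : mx_representation R[i] G3 8)
         (V : mx_representation R[i] G3 (12 + 8)),
    mx_faithful V /\
    (forall g, g \in G3 ->
       V g = block_mx (map_mx (real_complex R) (Vr g)) 0 0 (Vn g)) /\
    exists W : mx_representation R G3 (12 + 8 + 8),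
      mx_faithful W /\
      exists P : 'M[R[i]]_(12 + 8 + 8),
        P \in unitmx /\
        forall g, g \in G3 ->
          map_mx (real_complex R) (W g) *m P
          = P *m block_mx (V g) 0 0 (map_mx conjc (Vn g)).
Proof.
have reps := faithful_reps R.
have [Vr [Vn [V [injV [_ [W [injW _]]]]]]] := reps.
split; first by split=> [|m [rG /complex_lower_bound]] //; exists V.
by split=> //; split=> [|m [rG /real_lower_bound]] //; exists W.
Qed.
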